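(* Fix an integer $p\geq1$, integers $r_1,\ldots,r_p\geq0$ and real numbers $0\leq t_0<t_1<\cdots<t_p$. For each $i=1,\ldots,p$ and each $n\geq1$, let $$L_i(n)=n^{-r_i/2}\sum\{a_1,\ldots,a_{r_i}\}\in\mathbb{C}[\mathcal{G}],$$ where the sum runs over all $r_i$-tuples $(a_1,\ldots,a_{r_i})$ of pairwise distinct integers of $(nt_{i-1},nt_i]$. Then $L_1(n),\ldots,L_p(n)$ are asymptotically independent as $n$ goes to infinity.
   Context: $\mathcal{G}$ is the group of finite sets of nonnegative integers endowed with the symmetric difference operation $A\Delta B=(A\cup B)\setminus(A\cap B)$ (neutral element $\emptyset$). $\mathbb{C}[\mathcal{G}]$ is its (commutative) group algebra, with canonical trace $\psi(\sum_A x_A A)=x_\emptyset$. For $r_i=0$ the sum is just the unit $\emptyset$ of the algebra. The elements $L_1(n),\ldots,L_p(n)$ are asymptotically independent as $n\to\infty$ if their joint distribution (the map $P\mapsto\psi(P(L_1(n),\ldots,L_p(n)))$ on polynomials $P$ in $p$ variables) converges pointwise, on every such $P$, to the joint distribution $P\mapsto\mathbb{E}[P(x_1,\ldots,x_p)]$ of a family $(x_1,\ldots,x_p)$ of independent classical random variables having moments of all orders. *)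

(* Defs.v *)
From HB Require Import structures.
From mathcomp Require Import all_boot all_order all_algebra finmap complex.
From mathcomp Require Import all_classical all_reals all_analysis.
(* The notations of mpoly and monalg clash with those of mathcomp-analysis.
   The names they share (mcoeff, msupp, mmap) refer to monalg when unqualified. *)
From mathcomp Require Import -(notations) mpoly.
From mathcomp Require Import -(notations) monalg.

Set Implicit Arguments.
Unset Strict Implicit.
Unset Printing Implicit Defensive.

Import Order.TTheory GRing.Theory Num.Theory numFieldNormedType.Exports.

Local Open Scope ring_scope.

Definition finsets : Type := {fset nat}.

HB.instance Definition _ := Choice.on finsets.

Definition symdiff (A B : finsets) : finsets :=
  ((A `|` B) `\` (A `&` B))%fset.

Lemma in_symdiff (A B : finsets) k :
  (k \in symdiff A B) = (k \in (A : {fset nat})) (+) (k \in (B : {fset nat})).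
Proof. by rewrite !inE; do 2 case: (k \in _). Qed.

Lemma symdiffA : associative symdiff.
Proof. by move=> A B C; apply/fsetP => k; rewrite !in_symdiff addbA. Qed.

Lemma symdiffC : commutative symdiff.
Proof. by move=> A B; apply/fsetP => k; rewrite !in_symdiff addbC. Qed.

Lemma symdiff0 : left_id (fset0 : finsets) symdiff.
Proof. by move=> A; apply/fsetP => k; rewrite in_symdiff in_fset0. Qed.

Lemma symdiffK : left_inverse (fset0 : finsets) id symdiff.
Proof. by move=> A; apply/fsetP => k; rewrite in_symdiff addbb in_fset0. Qed.

(* The group law is written additively: A + B is the symmetric difference,
   0 is the empty set. *)
HB.instance Definition _ :=
  GRing.isZmodule.Build finsets symdiffA symdiffC symdiff0 symdiffK.

(* Group algebra over K of an abelian group G (written additively). The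
   finitely supported functions are those of multinomials' monalg, whose own
   product does not apply since it excludes monoids with nontrivial units. *)
Definition galg (K : comNzRingType) (G : zmodType) : Type := malg G K.

HB.instance Definition _ (K : comNzRingType) (G : zmodType) := GRing.Zmodule.on (galg K G).
HB.instance Definition _ (K : comNzRingType) (G : zmodType) := GRing.Lmodule.on (galg K G).

Section GroupAlgebra.
Variables (K : comNzRingType) (G : zmodType).
Implicit Types (x y z : galg K G) (g h : G).

Definition gcoef g x : K := mcoeff g x.

Definition gbasis g : galg K G := mkmalgU g 1.

Definition canonical_trace x : K := gcoef 0 x.

Definition galg_mul x y : galg K G :=
  \sum_(g <- msupp x) \sum_(h <- msupp y)
    (gcoef g x * gcoef h y) *: gbasis (g + h).

Lemma gcoefD g x y : gcoef g (x + y) = gcoef g x + gcoef g y.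
Proof. exact: mcoeffD. Qed.

Lemma gcoefZ g c x : gcoef g (c *: x) = c * gcoef g x.
Proof. exact: mcoeffZ. Qed.

Lemma gcoef_basis g h : gcoef h (gbasis g) = (g == h)%:R.
Proof. exact: mcoeffU. Qed.

Lemma galg_expand x (D : {fset G}) : (msupp x `<=` D)%fset ->
  x = \sum_(g <- D) gcoef g x *: gbasis g.
Proof.
move=> xD; rewrite [LHS](monalgEw xD); apply: eq_bigr => g _; apply/malgP => k.
by rewrite -/(gcoef k (_ *: _)) gcoefZ gcoef_basis mcoeffU mulr_natr.
Qed.

Lemma galg_mulEw x y (D E : {fset G}) :
  (msupp x `<=` D)%fset -> (msupp y `<=` E)%fset ->
  galg_mul x y = \sum_(g <- D) \sum_(h <- E)
    (gcoef g x * gcoef h y) *: gbasis (g + h).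
Proof.
move=> xD yE; rewrite /galg_mul (big_fset_incl _ xD) /=; last first.
  by move=> g _ /mcoeff_outdom xg; rewrite big1 // => h _;
     rewrite /gcoef xg mul0r scale0r.
apply: eq_bigr => g _; apply: big_fset_incl => // h _ /mcoeff_outdom yh.
by rewrite /gcoef yh mulr0 scale0r.
Qed.

Lemma galg_mulC : commutative galg_mul.
Proof.
move=> x y; rewrite /galg_mul exchange_big; apply: eq_bigr => g _.
by apply: eq_bigr => h _; rewrite mulrC addrC.
Qed.

Lemma galg_mulDl : left_distributive galg_mul +%R.
Proof.
move=> x y z; pose D := (msupp x `|` msupp y)%fset.
rewrite (@galg_mulEw (x + y) z D (msupp z)) ?msuppD_le //.
rewrite (@galg_mulEw x z D (msupp z)) ?fsubsetUl //.
rewrite (@galg_mulEw y z D (msupp z)) ?fsubsetUr //.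
rewrite -big_split; apply: eq_bigr => g _ /=.
rewrite -big_split; apply: eq_bigr => h _ /=.
by rewrite -scalerDl -mulrDl gcoefD.
Qed.

Lemma galg_mulZl c x y : c *: galg_mul x y = galg_mul (c *: x) y.
Proof.
rewrite (galg_mulEw (msuppZ_le c x) (fsubset_refl (msupp y))).
rewrite scaler_sumr; apply: eq_bigr => g _.
rewrite scaler_sumr; apply: eq_bigr => h _.
by rewrite scalerA mulrA gcoefZ.
Qed.

Lemma gbasisM g h : galg_mul (gbasis g) (gbasis h) = gbasis (g + h).
Proof.
rewrite (galg_mulEw (@msuppU_le _ _ g 1) (@msuppU_le _ _ h 1)).
by rewrite !big_seq_fset1 !gcoef_basis !eqxx mulr1 scale1r.
Qed.

Lemma galg_mul0l y : galg_mul 0 y = 0.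
Proof. by rewrite /galg_mul msupp0 big_seq_fset0. Qed.

Lemma galg_mul_suml I (s : seq I) (F : I -> galg K G) y :
  galg_mul (\sum_(i <- s) F i) y = \sum_(i <- s) galg_mul (F i) y.
Proof.
by apply: (big_morph (galg_mul^~ y) (fun _ _ => galg_mulDl _ _ _)
  (galg_mul0l y)).
Qed.

Lemma galg_mul_sumr I (s : seq I) (F : I -> galg K G) y :
  galg_mul y (\sum_(i <- s) F i) = \sum_(i <- s) galg_mul y (F i).
Proof.
rewrite galg_mulC galg_mul_suml; apply: eq_bigr => i _; exact: galg_mulC.
Qed.

Lemma galg_mulZr c x y : c *: galg_mul x y = galg_mul x (c *: y).
Proof. by rewrite galg_mulC galg_mulZl galg_mulC. Qed.

Lemma galg_mulUU c e g h :
  galg_mul (c *: gbasis g) (e *: gbasis h) = (c * e) *: gbasis (g + h).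
Proof. by rewrite -galg_mulZl -galg_mulZr scalerA gbasisM. Qed.

Lemma galg_mulA : associative galg_mul.
Proof.
move=> x y z.
rewrite (galg_expand (fsubset_refl (msupp x))).
rewrite (galg_expand (fsubset_refl (msupp y))).
rewrite (galg_expand (fsubset_refl (msupp z))).
set X := fun g => gcoef g x *: gbasis g.
set Y := fun g => gcoef g y *: gbasis g.
set Z := fun g => gcoef g z *: gbasis g.
rewrite (galg_mul_suml (msupp x) X (\sum_(h <- msupp y) Y h)).
rewrite !(galg_mul_suml (msupp x)); apply: eq_bigr => g _.
rewrite (galg_mul_suml (msupp y) Y) !(galg_mul_sumr (msupp y)).
rewrite (galg_mul_suml (msupp y)); apply: eq_bigr => h _.
rewrite !(galg_mul_sumr (msupp z)); apply: eq_bigr => k _.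
rewrite (galg_mulUU (gcoef h y)) (galg_mulUU (gcoef g x) (gcoef h y)).
by rewrite !galg_mulUU mulrA addrA.
Qed.

Lemma galg_mul1 : left_id (gbasis 0) galg_mul.
Proof.
move=> x; rewrite [x in LHS](galg_expand (fsubset_refl (msupp x))).
rewrite [RHS](galg_expand (fsubset_refl (msupp x))).
rewrite galg_mul_sumr; apply: eq_bigr => g _.
by rewrite -galg_mulZr gbasisM add0r.
Qed.

Lemma galg_oner_neq0 : gbasis 0 != 0.
Proof. by rewrite monalgU_eq0 oner_eq0. Qed.

End GroupAlgebra.

HB.instance Definition _ (K : comNzRingType) (G : zmodType) := GRing.Zmodule_isComNzRing.Build (galg K G)
  (@galg_mulA K G) (@galg_mulC K G) (@galg_mul1 K G) (@galg_mulDl K G)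
  (@galg_oner_neq0 K G).
HB.instance Definition _ (K : comNzRingType) (G : zmodType) := GRing.Lmodule_isLalgebra.Build K (galg K G)
  (@galg_mulZl K G).
HB.instance Definition _ (K : comNzRingType) (G : zmodType) := GRing.Lalgebra_isAlgebra.Build K (galg K G)
  (@galg_mulZr K G).

Section Probability.
Context {d : measure_display} {T : measurableType d} {R : realType}.
Variable P : probability T R.

Definition mutually_independent (I : finType) (x : I -> {RV P >-> R}) : Prop :=
  forall (J : {set I}) (B : I -> set R),
    (forall i, i \in J -> measurable (B i)) ->
    P (\bigcap_(i in [set` J]) (x i @^-1` B i))%classic =
      (\prod_(i in J) P (x i @^-1` B i)%classic)%E.

Definition has_all_moments (X : {RV P >-> R}) : Prop :=
  forall k : nat, P.-integrable setT (fun w => (X w ^+ k)%:E).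

(* Meaningful when the real and imaginary parts of f are integrable. *)
Definition Cexpectation (f : T -> R[i]) : R[i] :=
  (fine 'E_P[fun w => complex.Re (f w)] +i*
   fine 'E_P[fun w => complex.Im (f w)])%C.

Definition classical_joint_distribution (p : nat) (x : 'I_p -> {RV P >-> R})
    (Q : mpoly p R[i]) : R[i] :=
  Cexpectation (fun w => meval (fun i => (x i w)%:C%C) Q).

End Probability.

Definition joint_distribution (C : comNzRingType) (A : comAlgType C)
    (psi : A -> C) (p : nat) (a : 'I_p -> A) (Q : mpoly p C) : C :=
  psi (mpoly.mmap (GRing.in_alg A) a Q).

Definition asymptotically_independent (R : realType) (A : comAlgType R[i])
    (psi : A -> R[i]) (p : nat) (L : nat -> 'I_p -> A) : Prop :=
  exists (d : measure_display) (T : measurableType d) (P : probability T R)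
         (x : 'I_p -> {RV P >-> R}),
    [/\ mutually_independent x,
        forall i, has_all_moments (x i) &
        forall Q : mpoly p R[i],
          ((fun n => joint_distribution psi (L n) Q : (R[i])^o) @ \oo -->
            (classical_joint_distribution x Q : (R[i])^o))%classic].

(* The sum runs over the r-tuples of distinct integers of (n s, n t], for
   0 <= s; such integers are at most the integer part of n t. *)
Definition Lelem (R : realType) (r : nat) (s t : R) (n : nat) :
    galg R[i] finsets :=
  (n%:R `^ (- (r%:R / 2)))%:C%C *:
  \sum_(a : r.-tuple 'I_(Num.truncn (n%:R * t)).+1 |
         uniq a && all (fun k : 'I__ => n%:R * s < k%:R <= n%:R * t) a)
     gbasis _ ([fset nat_of_ord k | k in tval a]%fset : finsets).

(* Main.v *)
(* Write X_n = n^{-1/2} S, where S is the sum of the N singletons {a} with a in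
   (ns, nt].  As {a}{a} = 1, the sums E_r over r-tuples of distinct integers
   satisfy S E_r = E_{r+1} + r (N - r + 1) E_{r-1}, so that
     X_n L_r = L_{r+1} + (r (N - r + 1) / n) L_{r-1},
   while the trace of L_r is 0 for r > 0.  Hence L_r is a polynomial in X_n, and
   the moments of L_r are fixed polynomials in the recurrence coefficients.
   These coefficients converge to r (t - s), which are those of the Hermite
   polynomials orthogonal for the centered Gaussian law of variance t - s; so
   the moments of L_r converge to those of the r-th Hermite polynomial of a
   Gaussian variable.  The trace is multiplicative on elements supported by
   disjoint sets of integers, which gives the independence of the limits. *)

Require Import Defs.
From mathcomp Require Import all_boot all_order all_algebra finmap complex.
From mathcomp Require Import all_classical all_reals all_analysis.
From mathcomp Require Import measurable_realfun ring lra zify.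
(* As in Defs, the names shared by mpoly and monalg refer to monalg. *)
From mathcomp Require Import -(notations) mpoly.
From mathcomp Require Import -(notations) monalg.
Import Order.TTheory GRing.Theory Num.Theory.
Local Open Scope ring_scope.

Set Implicit Arguments.
Unset Strict Implicit.
Unset Printing Implicit Defensive.

(** * Sums over tuples of distinct integers *)

Section ElementarySymmetric.
Variable A : comNzRingType.

(** Generating polynomial whose coefficients are the elementary symmetric functions of the entries
    of [s]. *)
Definition esym_poly (s : seq A) : {poly A} := \prod_(u <- s) (1 + u%:P * 'X).

(** Let P be this polynomial, N the size of [s] and P_u the product over the entries other than u.
    As u^2 = 1, u P = (u + X) P_u; the u P_u sum to P', and the P_u = P - u X P_u sum to N P - X P'.
    One identity thus carries the recurrences of all degrees. *)
Lemma esym_poly_deriv (s : seq A) : (forall u, u \in s -> u * u = 1) ->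
  (\sum_(u <- s) u)%:P * esym_poly s =
  (esym_poly s)^`() +
    'X * ((size s)%:R * esym_poly s - 'X * (esym_poly s)^`()).
Proof.
rewrite /esym_poly; elim: s => [|u s IH] us.
  by rewrite !big_nil derivC polyC0 /=; ring.
rewrite !big_cons derivM derivD derivM derivX !derivC.
set P := \prod_(_ <- _) _; set Q := P^`().
have {IH} : (\sum_(j <- s) j)%:P * P = Q + 'X * ((size s)%:R * P - 'X * Q).
  by apply: IH => v vs; apply: us; rewrite inE vs orbT.
have uu : u%:P * u%:P = 1 :> {poly A} by rewrite -polyCM us ?inE ?eqxx.
set S := \sum_(j <- s) j; rewrite polyCD /= -addn1 natrD => IH.
have -> : (u%:P + S%:P) * ((1 + u%:P * 'X) * P) =
  (1 + u%:P * 'X) * (S%:P * P) + (u%:P + (u%:P * u%:P) * 'X) * P by ring.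
rewrite IH uu; ring: uu.
Qed.

End ElementarySymmetric.

Lemma esym_poly0 (A : comNzRingType) (s : seq A) : (esym_poly s)`_0 = 1.
Proof.
rewrite -horner_coef0 /esym_poly horner_prod big1 // => u _.
by rewrite !hornerE.
Qed.

Lemma esym_poly1 (A : comNzRingType) (s : seq A) :
  (esym_poly s)`_1 = \sum_(u <- s) u.
Proof.
elim: s => [|u s IH]; first by rewrite /esym_poly !big_nil coef1.
rewrite /esym_poly !big_cons -/(esym_poly s) mulrDl mul1r coefD IH.
by rewrite -mulrA coefCM coefXM esym_poly0 mulr1 addrC.
Qed.

Lemma esym_poly_rec (A : comNzRingType) (s : seq A) (r : nat) :
  (forall u, u \in s -> u * u = 1) ->
  (\sum_(u <- s) u) * (esym_poly s)`_r.+1 =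
  (esym_poly s)`_r.+2 *+ r.+2 +
    ((esym_poly s)`_r *+ size s - (esym_poly s)`_r *+ r).
Proof.
move=> /esym_poly_deriv /(congr1 (fun p : {poly A} => p`_r.+1)).
rewrite coefCM coefD coef_deriv coefXM /= => ->; congr (_ + _).
rewrite coefB mulr_natl coefMn coefXM; congr (_ - _).
(* In degree 0 the coefficient of X P' is 0, as is the term multiplied by r = 0. *)
by case: r => [|r] /=; rewrite ?mulr0n // coef_deriv.
Qed.

(** The factor r + 2 of [esym_poly_rec] turns (r + 1)! into (r + 2)!, while (r + 1)! = (r + 1) r!
    leaves r + 1 in front of N - r. The scalars stand for powers of n^(-1/2), known only through the
    two equations. *)
Lemma esym_scaled_rec (K : comNzRingType) (A : comAlgType K) (s : seq A)
    (r : nat) (a1 b c e : K) :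
  (forall u, u \in s -> u * u = 1) ->
  a1 * b = c -> c * (r.+1%:R * ((size s)%:R - r%:R)) = e ->
  (a1 *: \sum_(u <- s) u) * (b *: ((esym_poly s)`_r.+1 *+ r.+1`!)) =
  c *: ((esym_poly s)`_r.+2 *+ r.+2`!) + e *: ((esym_poly s)`_r *+ r`!).
Proof.
move=> us <- <-; rewrite -scalerAl -scalerAr scalerA mulrnAr esym_poly_rec //.
rewrite mulrnDl scalerDr; congr (_ + _); first by rewrite -mulrnA -factS.
set P := esym_poly s.
have -> : P`_r *+ size s - P`_r *+ r = ((size s)%:R - r%:R : K) *: P`_r.
  by rewrite scalerBl !scaler_nat.
rewrite -[in LHS](scaler_nat r.+1`!) -[in RHS](scaler_nat r`!) !scalerA.
by congr (_ *: _); rewrite factS natrM; ring.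
Qed.

(** The coefficient of degree r is a sum over the r-subsets of [D], and each of them is the set of
    entries of r! tuples. *)
Lemma sum_uniq_tuples (A : comNzRingType) (T : finType) (D : {pred T})
    (u : T -> A) (r : nat) :
  \sum_(a : r.-tuple T | uniq a && all (mem D) a) \prod_(k <- a) u k =
  r`!%:R * (esym_poly [seq u k | k <- enum D])`_r.
Proof.
rewrite /esym_poly big_map big_enum /=.
(* Extension by 0 outside [D] replaces the condition on the entries by vanishing terms. *)
pose v k := if k \in D then u k else 0.
have -> : \prod_(k in D) (1 + (u k)%:P * 'X) = \prod_k ((v k)%:P * 'X + 1).
  rewrite big_mkcond /=; apply: eq_bigr => k _; rewrite /v.
  by case: ifP => _; rewrite ?polyC0 ?mul0r ?add0r // addrC.
have -> : \sum_(a : r.-tuple T | uniq a && all (mem D) a) \prod_(k <- a) u k =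
    \sum_(a : r.-tuple T | uniq a) \prod_(k <- a) v k.
  rewrite big_mkcondr /=; apply: eq_bigr => a _; case: allP => aD.
    by apply: eq_big_seq => k /aD kD; rewrite /v ifT.
  have /allPn[k ka kD] : ~~ all (mem D) a by apply/allP.
  by rewrite (big_rem k) //= {1}/v ifN ?mul0r.
rewrite bigA_distr coef_sum mulr_sumr.
rewrite (partition_big (fun a : r.-tuple T => [set k in a]) predT) //=.
apply: eq_bigr => J _.
have -> : (\prod_i (if i \in J then (v i)%:P * 'X else 1))`_r =
    (\prod_(i in J) v i) *+ (#|J| == r) :> A.
  rewrite -big_mkcond big_split /= prodr_const -rmorph_prod coefCM coefXn.
  by rewrite eq_sym mulr_natr.
transitivity (\sum_(a : r.-tuple T | uniq a && ([set k in a] == J))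
    \prod_(i in J) v i).
  apply: eq_bigr => a /andP[ua /eqP <-]; rewrite big_uniq //=.
  by apply: eq_bigl => k; rewrite inE.
rewrite sumr_const mulrnAr mulr_natl -mulrnA; congr (_ *+ _).
have [Jr|Jr] := eqVneq; last first.
  rewrite muln0; apply: eq_card0 => a; rewrite unfold_in.
  apply/negP => /andP[ua /eqP aJ]; move: Jr.
  by rewrite -aJ cardsE (card_uniqP ua) size_tuple eqxx.
have := card_uniq_tuples r (mem J); rewrite muln1 Jr ffactnn => <-.
apply: eq_card => a; rewrite [RHS]inE [LHS]unfold_in andbC.
case ua: (uniq a); rewrite ?andbF ?andbT //.
apply/eqP/allP => [<- k ka|aJ]; first by rewrite !inE.
apply/eqP; rewrite eqEcard Jr cardsE (card_uniqP ua) size_tuple leqnn andbT.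
by apply/fintype.subsetP => k; rewrite inE => /aJ.
Qed.

(** Without repetitions nothing cancels: the symmetric difference of the singletons is their
    union. *)
Lemma symdiff_basis_prod (K : comNzRingType) (s : seq nat) : uniq s ->
  gbasis K ([fset k | k in s]%fset : finsets) =
  \prod_(k <- s) gbasis K ([fset k]%fset : finsets) :> galg K finsets.
Proof.
elim: s => [_|a s IH] /=.
  rewrite big_nil; congr gbasis; apply/fsetP => k.
  by rewrite !inE.
case/andP=> as_ us; rewrite big_cons -IH // -[RHS]/(galg_mul _ _) gbasisM.
congr gbasis.
apply/fsetP => k; rewrite in_symdiff !inE; case: eqP => // -> /=.
by rewrite (negbTE as_).
Qed.

(** * Recurrence and trace of the elements of the group algebra *)

Section Lelem.
Variable R : realType.
Local Notation A := (galg R[i] finsets).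

(** The recurrence coefficients are real while the algebra is complex; this embeds them as
    scalars. *)
Definition real_galg : {rmorphism R -> A} :=
  GRing.in_alg A \o real_complex R.

Lemma real_galgE c (x : A) : real_galg c * x = c%:C%C *: x.
Proof. exact: mulr_algl. Qed.

Section Recurrence.
Variables (s t : R) (n : nat).
Hypothesis n_gt0 : (0 < n)%N.

Definition itv_pred m : {pred 'I_m} :=
  fun k => n%:R * s < k%:R <= n%:R * t.

Definition itv_card : nat := #|@itv_pred (Num.truncn (n%:R * t)).+1|.

Definition sing m (k : 'I_m) : A :=
  gbasis R[i] ([fset (k : nat)]%fset : finsets).

Let P :=
  esym_poly [seq sing k | k <- enum (@itv_pred (Num.truncn (n%:R * t)).+1)].
Let a r : R := n%:R `^ (- (r%:R / 2)).

Lemma LelemE r : Lelem r s t n = (a r)%:C%C *: (P`_r *+ r`!).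
Proof.
rewrite /Lelem; congr (_ *: _).
rewrite -[RHS]mulr_natl -sum_uniq_tuples; apply: eq_bigr => b /andP[ub _].
rewrite -(big_map (@nat_of_ord _) predT
  (fun k => gbasis R[i] ([fset k]%fset : finsets))).
rewrite -symdiff_basis_prod ?(map_inj_uniq val_inj) //; congr gbasis.
apply/fsetP => k; rewrite !inE.
apply/imfsetP/mapP => /= -[j jb ->]; by exists j.
Qed.

Lemma powR_half_sum r : a r.+2 = a 1 * a r.+1.
Proof.
rewrite /a -(@powRD R n%:R) ?pnatr_eq0 -?lt0n ?n_gt0 ?implybT //.
congr (_ `^ _).
rewrite -(addn2 r) -(addn1 r) !natrD; lra.
Qed.

Lemma powR_half_div r : a r.+2 = a r / n%:R.
Proof.
rewrite /a -[n%:R^-1]powR_inv1 ?ler0n //.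
rewrite -powRD ?pnatr_eq0 -?lt0n ?n_gt0 ?implybT //.
congr (_ `^ _); rewrite -(addn2 r) !natrD; lra.
Qed.

Lemma Lelem0 : Lelem 0 s t n = 1.
Proof.
by rewrite LelemE /a mul0r oppr0 powRr0 esym_poly0 fact0 mulr1n rmorph1 scale1r.
Qed.

(** The recurrence is taken at index r + 1, so N - r stands for N - (r + 1) + 1. Each singleton
    squares to the unit, as [esym_scaled_rec] requires. *)
Lemma Lelem_rec r :
  Lelem 1 s t n * Lelem r.+1 s t n = Lelem r.+2 s t n +
    (r.+1%:R * (itv_card%:R - r%:R) / n%:R)%:C%C *: Lelem r s t n.
Proof.
rewrite !LelemE esym_poly1 mulr1n scalerA.
apply: esym_scaled_rec.
- move=> _ /mapP[k _ ->]; rewrite -[_ * _]/(galg_mul _ _) gbasisM.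
  by rewrite [_ + _](symdiffK ([fset (k : nat)]%fset : finsets)).
- by rewrite -rmorphM -powR_half_sum.
rewrite powR_half_div size_map -cardE -/itv_card.
rewrite -!(rmorph_nat (real_complex R)) -rmorphB -!rmorphM /=.
congr (_%:C%C); ring.
Qed.

Lemma trace_Lelem r : canonical_trace (Lelem r s t n) = (r == 0%N)%:R.
Proof.
case: r => [|r]; first by rewrite Lelem0 /canonical_trace gcoef_basis eqxx.
rewrite /canonical_trace gcoefZ.
rewrite [X in _ * X](_ : _ = 0) ?mulr0 //.
rewrite (big_morph (gcoef 0) (gcoefD 0) (mcoeff0 _)) big1 // => b _.
(* The set contains the first entry of the tuple, so it is not empty. *)
rewrite gcoef_basis (_ : (_ == _) = false) //; apply/eqP => /fsetP/(_ (thead b)).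
rewrite in_fset0 => /negbT/negP; apply; apply/imfsetP.
by exists (thead b); rewrite ?mem_tnth.
Qed.

End Recurrence.
End Lelem.

(** * Multiplicativity of the trace on disjoint supports *)

Section Supports.
Variable K : comNzRingType.
Local Notation A := (galg K finsets).
Implicit Types (D E : {pred nat}) (x y : A).

(** Membership in the subalgebra spanned by the finite subsets of [D]. *)
Definition supported_on D x : Prop :=
  forall g : finsets, gcoef g x != 0 ->
    forall k, k \in (g : {fset nat}) -> k \in D.

Lemma supported_on_sub D E x : {subset D <= E} ->
  supported_on D x -> supported_on E x.
Proof. by move=> DE xD g /xD gD k /gD /DE. Qed.

Lemma supported_on_basis D (g : finsets) :
  (forall k, k \in (g : {fset nat}) -> k \in D) -> supported_on D (gbasis K g).
Proof.
move=> gD h; rewrite gcoef_basis; case: (eqVneq g h) => [<-|_] //.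
by rewrite eqxx.
Qed.

Lemma supported_on1 D : supported_on D 1.
Proof. by apply: supported_on_basis => k; rewrite in_fset0. Qed.

Lemma supported_onZ D c x : supported_on D x -> supported_on D (c *: x).
Proof.
move=> xD g; rewrite gcoefZ => cx; apply: xD.
by apply: contraNneq cx => ->; rewrite mulr0.
Qed.

Lemma gcoef_sum I (s : seq I) (P : pred I) (F : I -> A) g :
  gcoef g (\sum_(i <- s | P i) F i) = \sum_(i <- s | P i) gcoef g (F i).
Proof. exact: (big_morph (gcoef g) (gcoefD g) (mcoeff0 _)). Qed.

Lemma supported_on_sum D I (s : seq I) (P : pred I) (F : I -> A) :
  (forall i, P i -> supported_on D (F i)) ->
  supported_on D (\sum_(i <- s | P i) F i).
Proof.
move=> FD g; rewrite gcoef_sum => nz k kg; apply/negPn/negP => kD.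
move: nz; rewrite big1 ?eqxx // => i Pi.
by apply/eqP/negPn/negP => /(FD i Pi)/(_ _ kg); exact/negP.
Qed.

Lemma supported_onM D x y :
  supported_on D x -> supported_on D y -> supported_on D (x * y).
Proof.
move=> xD yD; rewrite -[x * y]/(galg_mul x y) /galg_mul.
rewrite big_seq_cond; apply: supported_on_sum => g /andP[gx _].
rewrite big_seq_cond; apply: supported_on_sum => h /andP[hy _].
apply/supported_onZ/supported_on_basis => k; rewrite in_symdiff => kgh.
have /xD gD : gcoef g x != 0 by rewrite mcoeff_neq0.
have /yD hD : gcoef h y != 0 by rewrite mcoeff_neq0.
by case: (boolP (k \in (g : {fset nat}))) kgh => [/gD //|_ /= /hD].
Qed.

Lemma supported_onX D x k : supported_on D x -> supported_on D (x ^+ k).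
Proof.
move=> xD; elim: k => [|k IH]; first exact: supported_on1.
by rewrite exprS; apply: supported_onM.
Qed.

(** A product of basis elements g and h contributes only if g = h; this set then lies in both [D]
    and [E], so it is empty. *)
Lemma canonical_traceM D E x y : supported_on D x -> supported_on E y ->
  (forall k, k \in D -> k \in E -> False) ->
  canonical_trace (x * y) = canonical_trace x * canonical_trace y.
Proof.
move=> xD yE DE.
have traceE (z : A) : canonical_trace z =
    \sum_(g <- msupp z) gcoef g z * (g == 0)%:R.
  rewrite /canonical_trace {1}(galg_expand (fsubset_refl (msupp z))) gcoef_sum.
  by apply: eq_bigr => g _; rewrite gcoefZ gcoef_basis.
have -> : canonical_trace (x * y) = \sum_(g <- msupp x) \sum_(h <- msupp y)
    gcoef g x * gcoef h y * (g + h == 0)%:R.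
  rewrite /canonical_trace gcoef_sum; apply: eq_bigr => g _.
  by rewrite gcoef_sum; apply: eq_bigr => h _; rewrite gcoefZ gcoef_basis.
rewrite !traceE big_distrlr; apply: eq_big_seq => g gx; apply: eq_big_seq => h hy.
rewrite /= [RHS]mulrACA; congr (_ * _).
have /xD gD : gcoef g x != 0 by rewrite mcoeff_neq0.
have /yE hE : gcoef h y != 0 by rewrite mcoeff_neq0.
rewrite -natrM mulnb; congr ((nat_of_bool _)%:R).
apply/eqP/andP => [gh|[/eqP -> /eqP ->]]; last by rewrite add0r.
have ghE k : (k \in (g : {fset nat})) = (k \in (h : {fset nat})).
  have := congr1 (fun u : finsets => k \in (u : {fset nat})) gh.
  by rewrite in_symdiff in_fset0; do 2 case: (_ \in _).
split; apply/eqP/fsetP => k; rewrite in_fset0; apply/negP.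
  by move=> kg; apply: (DE k); [exact: gD|apply: hE; rewrite -ghE].
by move=> kh; apply: (DE k); [apply: gD; rewrite ghE|exact: hE].
Qed.

Lemma canonical_trace_prod (I : eqType) (s : seq I) (D : I -> {pred nat})
    (y : I -> A) : uniq s ->
  (forall i, supported_on (D i) (y i)) ->
  (forall i j k, k \in D i -> k \in D j -> i = j) ->
  canonical_trace (\prod_(i <- s) y i) = \prod_(i <- s) canonical_trace (y i).
Proof.
move=> us yD DD.
(* The induction must also carry the support of the partial products, namely the union of the
   [D i]. *)
suff [] : canonical_trace (\prod_(i <- s) y i) =
      \prod_(i <- s) canonical_trace (y i) /\
    supported_on [pred k | has (fun i => k \in D i) s] (\prod_(i <- s) y i).
  by [].
elim: s us => [_|i s IH /= /andP[si us]].
  rewrite !big_nil; split; last exact: supported_on1.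
  by rewrite /canonical_trace gcoef_basis eqxx.
have [IH1 IH2] := IH us; rewrite !big_cons; split; last first.
  apply: supported_onM.
    by apply: supported_on_sub (yD i) => k ki; rewrite inE /= ki.
  by apply: supported_on_sub IH2 => k; rewrite !inE /= => ->; rewrite orbT.
rewrite (canonical_traceM (yD i) IH2) ?IH1 // => k ki /hasP[j js kj].
by move: si; rewrite (DD _ _ _ ki kj) js.
Qed.

Lemma canonical_traceD : {morph @canonical_trace K finsets : x y / x + y}.
Proof. exact: gcoefD. Qed.

Lemma canonical_trace0 : @canonical_trace K finsets 0 = 0.
Proof. exact: mcoeff0. Qed.

End Supports.

Lemma supported_on_Lelem (R : realType) r (s t : R) n :
  supported_on [pred k | n%:R * s < k%:R <= n%:R * t] (Lelem r s t n).
Proof.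
apply/supported_onZ/supported_on_sum => a /andP[_ /allP a_in].
apply: supported_on_basis => k /imfsetP[j /= ja ->]; exact: a_in.
Qed.

(** * Polynomials and moments of a three-term recurrence *)

Section ThreeTermRecurrence.
Variable R : comNzRingType.
Implicit Types (lam : nat -> R) (p : {poly R}).

(** For lam j = j c with c > 0 real, these are the monic Hermite polynomials of the centered
    Gaussian law of variance c. *)
Fixpoint orth_poly lam (r : nat) : {poly R} :=
  if r is r1.+1 then
    'X * orth_poly lam r1 -
    (if r1 is r2.+1 then lam r1 *: orth_poly lam r2 else 0)
  else 1.

(* The value at 'X^k * orth_poly lam r of the linear form that sends orth_poly lam r
   to (r == 0)%:R; orth_trace is this form. The value of lam at 0 is irrelevant. *)
Fixpoint orth_moment lam (k r : nat) : R :=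
  if k is k1.+1 then
    orth_moment lam k1 r.+1 +
    (if r is r1.+1 then lam r * orth_moment lam k1 r1 else 0)
  else (r == 0%N)%:R.

Definition orth_trace lam p : R := \sum_(j < size p) p`_j * orth_moment lam j 0.

Lemma orth_polySS lam r :
  orth_poly lam r.+2 = 'X * orth_poly lam r.+1 - lam r.+1 *: orth_poly lam r.
Proof. by []. Qed.

Lemma size_orth_poly lam r : (size (orth_poly lam r) <= r.+1)%N.
Proof.
suff [] : (size (orth_poly lam r) <= r.+1)%N /\
    (size (orth_poly lam r.+1) <= r.+2)%N by [].
elim: r => [|r [IH1 IH2]].
  by rewrite /= size_poly1 subr0 mulr1 size_polyX.
split=> //; rewrite orth_polySS (leq_trans (size_polyD _ _)) //.
rewrite geq_max size_polyN (leq_trans (size_scale_leq _ _)); last first.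
  by rewrite (leq_trans IH1) // ltnW.
by rewrite andbT (leq_trans (size_polyMleq _ _)) // size_polyX.
Qed.

Lemma orth_traceE lam p n : (size p <= n)%N ->
  orth_trace lam p = \sum_(j < n) p`_j * orth_moment lam j 0.
Proof.
move=> pn; rewrite /orth_trace.
rewrite (big_ord_widen n (fun j => p`_j * orth_moment lam j 0)) //.
rewrite big_mkcond; apply: eq_bigr => j _; case: ltnP => // pj.
by rewrite nth_default // mul0r.
Qed.

(** Solving the recurrence for L (r + 2) makes every [L r] a polynomial in [X]; applying it to X^k
    (L r) lowers k and reproduces the recursion of [orth_moment]. The lemma serves both for [Lelem]
    at fixed n and for Gaussian expectations, so that the two sides of the limit become values of
    [orth_trace]. *)
Lemma orth_trace_eval (K : comNzRingType) (f : {rmorphism R -> K})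
    (A : comNzRingType) (iota : {rmorphism R -> A}) (psi : A -> K)
    (psiD : {morph psi : x y / x + y}) (psi0 : psi 0 = 0)
    (psiZ : forall c x, psi (iota c * x) = f c * psi x)
    lam (L : nat -> A) (X : A)
    (L0 : L 0%N = 1) (L1 : L 1%N = X)
    (LS : forall r, X * L r.+1 = L r.+2 + iota (lam r.+1) * L r)
    (psiL : forall r, psi (L r) = (r == 0%N)%:R) :
  (forall r, L r = (map_poly iota (orth_poly lam r)).[X]) /\
  forall p, psi (map_poly iota p).[X] = f (orth_trace lam p).
Proof.
split.
  move=> r.
  suff : L r = (map_poly iota (orth_poly lam r)).[X] /\
         L r.+1 = (map_poly iota (orth_poly lam r.+1)).[X] by case.
  elim: r => [|r [IH1 IH2]].
    by rewrite /= subr0 mulr1 map_polyX rmorph1 !hornerE.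
  split=> //; rewrite orth_polySS rmorphB rmorphM /= map_polyX map_polyZ /=.
  by rewrite !hornerE -IH1 -IH2 LS addrK.
have mom k : forall r, psi (X ^+ k * L r) = f (orth_moment lam k r).
  elim: k => [|k IH] r; first by rewrite expr0 mul1r psiL rmorph_nat.
  rewrite exprSr -mulrA; case: r => [|r] /=.
    by rewrite L0 mulr1 -{2}L1 IH addr0.
  by rewrite LS mulrDr psiD IH mulrCA psiZ IH rmorphD rmorphM.
move=> p; rewrite (horner_coef_wide _ (size_poly _ _)) (big_morph psi psiD psi0).
rewrite /orth_trace rmorph_sum; apply: eq_bigr => j _.
by rewrite coef_map psiZ -[X ^+ j]mulr1 -L0 mom rmorphM.
Qed.

(** Derivative rule of the Hermite polynomials H_r. Differentiating the recurrence for H_(r+3) gives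
    H_(r+2) + (r + 2) (X H_(r+1) - (r + 1) c H_r), and the bracket is H_(r+2) again. *)
Lemma orth_poly_deriv (c : R) r :
  (orth_poly (fun j => j%:R * c) r.+1)^`() =
  r.+1%:R *: orth_poly (fun j => j%:R * c) r.
Proof.
pose lam j : R := j%:R * c; rewrite -/lam.
suff [] : (orth_poly lam r.+1)^`() = r.+1%:R *: orth_poly lam r /\
   (orth_poly lam r.+2)^`() = r.+2%:R *: orth_poly lam r.+1 by [].
elim: r => [|r [IH1 IH2]].
  have P1 : orth_poly lam 1 = 'X by rewrite /= subr0 mulr1.
  split; first by rewrite P1 derivX scale1r.
  rewrite orth_polySS P1 (erefl : orth_poly lam 0 = 1) alg_polyC.
  rewrite derivB derivM derivX mul1r mulr1 derivC.
  by rewrite subr0 scaler_nat mulr2n.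
split=> //; rewrite orth_polySS derivB derivM derivX derivZ mul1r IH2 IH1.
have E := orth_polySS lam r; move: E.
move: (orth_poly lam r.+2) (orth_poly lam r.+1) (orth_poly lam r) => P2 P1 P0.
rewrite -!mul_polyC /lam !polyCM !polyC_natr => E.
rewrite E; ring.
Qed.

End ThreeTermRecurrence.

Import numFieldNormedType.Exports.
Local Open Scope classical_set_scope.

(** * Continuity in the recurrence coefficients *)

Section Continuity.
Variable R : realType.
Implicit Types (lam : nat -> nat -> R) (p : nat -> {poly R}).

Lemma cvg_sumr (I : Type) (s : seq I) (u : I -> nat -> R) (l : I -> R) :
  (forall i, u i n @[n --> \oo] --> l i) ->
  \sum_(i <- s) u i n @[n --> \oo] --> \sum_(i <- s) l i.
Proof.
by move=> ul; apply: cvg_big => [x|i _]; [exact: add_continuous|exact: ul].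
Qed.

Lemma cvg_prodr (I : Type) (s : seq I) (u : I -> nat -> R) (l : I -> R) :
  (forall i, u i n @[n --> \oo] --> l i) ->
  \prod_(i <- s) u i n @[n --> \oo] --> \prod_(i <- s) l i.
Proof.
by move=> ul; apply: cvg_big => [x|i _]; [exact: mul_continuous|exact: ul].
Qed.

Variables (lam_ : nat -> nat -> R) (lam : nat -> R).
Hypothesis lam_cvg : forall r, lam_ n r @[n --> \oo] --> lam r.

Lemma cvg_orth_moment k r :
  orth_moment (lam_ n) k r @[n --> \oo] --> orth_moment lam k r.
Proof.
elim: k r => [|k IH] r /=; first exact: cvg_cst.
apply: cvgD; first exact: IH.
by case: r => [|r]; [exact: cvg_cst|apply: cvgM].
Qed.

Definition cvg_coefs (p : nat -> {poly R}) (q : {poly R}) :=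
  forall j, (p n)`_j @[n --> \oo] --> q`_j.

Lemma cvg_coefsM p1 q1 p2 q2 : cvg_coefs p1 q1 -> cvg_coefs p2 q2 ->
  cvg_coefs (fun n => p1 n * p2 n) (q1 * q2).
Proof.
move=> H1 H2 j; rewrite coefM; under eq_cvg do rewrite coefM.
by apply: cvg_sumr => i; apply: cvgM; [exact: H1|exact: H2].
Qed.

Lemma cvg_coefs_cst q : cvg_coefs (fun=> q) q.
Proof. by move=> j; exact: cvg_cst. Qed.

Lemma cvg_coefs_orth_poly r :
  cvg_coefs (fun n => orth_poly (lam_ n) r) (orth_poly lam r).
Proof.
suff : cvg_coefs (fun n => orth_poly (lam_ n) r) (orth_poly lam r) /\
  cvg_coefs (fun n => orth_poly (lam_ n) r.+1) (orth_poly lam r.+1) by case.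
elim: r => [|r [IH1 IH2]].
  by split=> j /=; exact: cvg_cst.
split=> // j; rewrite orth_polySS coefB coefZ.
under eq_cvg do rewrite orth_polySS coefB coefZ.
apply: cvgB; last by apply: cvgM; [exact: lam_cvg|exact: IH1].
exact: (cvg_coefsM (@cvg_coefs_cst 'X) IH2).
Qed.

Lemma cvg_coefsX p q k : cvg_coefs p q ->
  cvg_coefs (fun n => p n ^+ k) (q ^+ k).
Proof.
move=> pq; elim: k => [|k IH]; first exact: cvg_coefs_cst.
rewrite exprS => j; under eq_cvg do rewrite exprS.
exact: cvg_coefsM.
Qed.

(** The uniform degree bound turns all the traces into sums over the same [N] terms. *)
Lemma cvg_orth_trace p q N : (forall n, (size (p n) <= N)%N) ->
  cvg_coefs p q ->
  orth_trace (lam_ n) (p n) @[n --> \oo] --> orth_trace lam q.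
Proof.
move=> pN pq.
(* Beyond [N] the coefficients of [q] are limits of zeros, so [q] inherits the bound. *)
have qN : (size q <= N)%N.
  apply/leq_sizeP => j Nj.
  have : (p n)`_j @[n --> \oo] --> (0 : R).
    under eq_cvg do rewrite nth_default ?(leq_trans (pN _)) //.
    exact: cvg_cst.
  by move=> p0; exact: (cvg_unique _ (pq j) p0).
rewrite (orth_traceE _ qN); under eq_cvg do rewrite (orth_traceE _ (pN _)).
by apply: cvg_sumr => j; apply: cvgM; [exact: pq|exact: cvg_orth_moment].
Qed.

Lemma cvg_orth_trace_power r k :
  orth_trace (lam_ n) (orth_poly (lam_ n) r ^+ k) @[n --> \oo] -->
  orth_trace lam (orth_poly lam r ^+ k).
Proof.
apply: (@cvg_orth_trace _ _ (r * k).+1); last first.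
  by apply: cvg_coefsX; exact: cvg_coefs_orth_poly.
move=> n; apply: leq_trans (size_poly_exp_leq _ _) _.
rewrite ltnS leq_mul2r -subn1 leq_subLR add1n size_orth_poly orbT //.
Qed.

End Continuity.

(** * Gaussian moments *)

Section GaussianMoments.
Variable R : realType.
Local Notation mu := (@lebesgue_measure R).

(** A single term of the exponential series of a x^2 is bounded by its sum. *)
Lemma expr_le_expR (m : nat) (a x : R) : 0 < a ->
  x ^+ m.*2 <= m`!%:R / a ^+ m * expR (a * x ^+ 2).
Proof.
move=> a0; rewrite mulrAC ler_pdivlMr ?exprn_gt0 //.
rewrite mulrC -mul2n exprM -exprMn.
have u0 : 0 <= a * x ^+ 2 by rewrite mulr_ge0 ?sqr_ge0 // ltW.
case: m => [|m]; first by rewrite expr0 fact0 mul1r -expR0 ler_expR.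
have := expR_ge1Dxn m u0.
rewrite -ler_pdivrMl ?ltr0n ?fact_gt0 // mulrC; apply: le_trans.
by rewrite lerDr ler01.
Qed.

Variable s : R.
Hypothesis s_neq0 : s != 0.

Local Notation pdf := (normal_pdf 0 s).

Lemma normal_pdf0E x : pdf x = normal_peak s * expR (- x ^+ 2 / (s ^+ 2 *+ 2)).
Proof. by rewrite normal_pdfE // /normal_fun subr0. Qed.

(** Doubling the standard deviation frees a Gaussian factor that absorbs any power of x. The bound
    yields both integrability and decay at infinity. *)
Lemma normal_pdf_moment_le (m : nat) : exists C : R, forall x,
  `|x ^+ m| * pdf x <= C * normal_pdf 0 (2 * s) x.
Proof.
(* 1 / (2 s^2) - 1 / (8 s^2), the gap between the exponents of the two densities. *)
pose a : R := 3 / (8 * s ^+ 2).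
have s2 : 0 < s ^+ 2 by rewrite exprn_even_gt0.
have a0 : 0 < a by rewrite /a; apply: divr_gt0; [lra|apply: mulr_gt0; [lra|]].
have s'0 : 2 * s != 0 by rewrite mulf_neq0.
have pk0 : 0 < normal_peak (2 * s) by rewrite normal_peak_gt0.
pose D : R := 1 + m`!%:R / a ^+ m.
exists (D * (normal_peak s / normal_peak (2 * s))) => x.
rewrite normal_pdf0E [normal_pdf 0 (2 * s)]normal_pdfE // /normal_fun subr0.
rewrite -!mulrA mulKf ?gt_eqF // mulrCA [leRHS]mulrCA.
rewrite ler_pM2l ?normal_peak_gt0 //.
have -> : expR (- x ^+ 2 / ((2 * s) ^+ 2 *+ 2)) =
    expR (a * x ^+ 2) * expR (- x ^+ 2 / (s ^+ 2 *+ 2)).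
  by rewrite -expRD; congr expR; rewrite /a; field.
rewrite mulrA ler_pM2r ?expR_gt0 //.
(* For y = |x^m|, (y - 1/2)^2 >= 0 gives y <= y^2 + 1/4. *)
have : `|x ^+ m| <= 1 + x ^+ m.*2.
  rewrite -addnn exprD -expr2 -real_normK ?num_real //.
  have := sqr_ge0 (`|x ^+ m| - 2^-1); nra.
move=> /le_trans; apply; rewrite /D mulrDl mul1r lerD ?expr_le_expR //.
by rewrite -[leLHS]expR0 ler_expR mulr_ge0 ?sqr_ge0 // ltW.
Qed.

Lemma integrable_normal_pdf_moment (m : nat) :
  mu.-integrable setT (fun x => (x ^+ m * pdf x)%:E).
Proof.
have [C HC] := normal_pdf_moment_le m.
have intC : mu.-integrable setT (fun x => (C * normal_pdf 0 (2 * s) x)%:E).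
  under eq_fun do rewrite EFinM.
  by apply: integrableZl => //; exact: integrable_normal_pdf.
apply: le_integrable intC => //.
  apply/measurable_EFinP/measurable_funM; last exact: measurable_normal_pdf.
  exact: measurable_funX.
move=> x _; rewrite lee_fin normrM (ger0_norm (normal_pdf_ge0 0 s x)).
exact: le_trans (HC x) (ler_norm _).
Qed.

Lemma is_derive_normal_pdf (x : R) :
  is_derive x 1 (pdf : R -> R^o) (- x / s ^+ 2 * pdf x).
Proof.
have -> : pdf =
    (fun x => normal_peak s * expR (- x ^+ 2 / (s ^+ 2 *+ 2))) :> (R -> R).
  by apply/funext => y; exact: normal_pdf0E.
have e : is_derive x 1 (fun y : R => expR (- y ^+ 2 / (s ^+ 2 *+ 2)) : R^o)
    (expR (- x ^+ 2 / (s ^+ 2 *+ 2)) * (- (x *+ 2) / (s ^+ 2 *+ 2))).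
  apply: is_derive1_comp.
  apply: is_derive_eq.
  by rewrite /GRing.scale /=; field.
apply: is_derive_eq.
by rewrite /GRing.scale /=; field.
Qed.

Definition pdf_moment k (x : R) : R := x ^+ k * pdf x.

(** At k = 0 the truncated predecessor is harmless, since its term has the factor k. *)
Lemma is_derive_pdf_moment k (x : R) :
  is_derive x 1 (pdf_moment k : R -> R^o)
    (k%:R * pdf_moment k.-1 x - pdf_moment k.+1 x / s ^+ 2).
Proof.
have dp := is_derive_normal_pdf x.
have dX : is_derive x 1 (fun y : R => y ^+ k : R^o) (k%:R * x ^+ k.-1).
  have := @is_deriveX R R^o id k x 1 1 (is_derive_id x 1).
  by rewrite /GRing.scale /= mulr1 fctE.
apply: (is_derive_eq (is_deriveM dX dp)).
by rewrite /GRing.scale /= /pdf_moment !exprS; field.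
Qed.

(** One more power of x still gives a bounded function, whence a decay in 1 / |x|. *)
Lemma pdf_moment_vanish k : exists C : R, 0 <= C /\ forall n : nat,
  `|pdf_moment k n.+1%:R| <= C / n.+1%:R /\
  `|pdf_moment k (- n.+1%:R)| <= C / n.+1%:R.
Proof.
have [C HC] := normal_pdf_moment_le k.+1.
have s'0 : 2 * s != 0 by rewrite mulf_neq0.
have HD x : `|x| * `|pdf_moment k x| <= `|C| * normal_peak (2 * s).
  rewrite -normrM /pdf_moment mulrA -exprS normrM.
  rewrite (ger0_norm (normal_pdf_ge0 0 s x)).
  apply: le_trans (HC x) _; apply: le_trans (ler_wpM2r _ (ler_norm C)) _.
    exact: normal_pdf_ge0.
  by rewrite ler_wpM2l // normal_pdf_ub.
exists (`|C| * normal_peak (2 * s)); split.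
  by rewrite mulr_ge0 // normal_peak_ge0.
move=> n; split; rewrite ler_pdivlMr ?ltr0n // mulrC.
  by have := HD n.+1%:R; rewrite normr_nat.
by have := HD (- n.+1%:R); rewrite normrN normr_nat.
Qed.

Lemma continuous_pdf_moment k : continuous (pdf_moment k).
Proof.
move=> x; apply: cvgM; last exact: continuous_normal_pdf.
exact: exprn_continuous.
Qed.

(** The integrand is the derivative of [pdf_moment s k]: over [-(n + 1), n + 1] its integral is a
    difference of boundary values, which tends to 0, and dominated convergence extends this to the
    line. *)
Lemma integral_pdf_moment_deriv k :
  (\int[mu]_x (k%:R * pdf_moment k.-1 x - pdf_moment k.+1 x / s ^+ 2)%:E = 0)%E.
Proof.
set f := fun x : R => k%:R * pdf_moment k.-1 x - pdf_moment k.+1 x / s ^+ 2.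
have cf : continuous f.
  move=> x; apply: cvgB; apply: cvgM; try exact: cvg_cst;
  exact: continuous_pdf_moment.
have mf : measurable_fun setT f by exact: continuous_measurable_fun.
have intf : mu.-integrable setT (EFin \o f).
  have -> : EFin \o f = (fun x => k%:R%:E * (pdf_moment k.-1 x)%:E -
      (s ^+ 2)^-1%:E * (pdf_moment k.+1 x)%:E)%E.
    apply/funext => x.
    by rewrite /= /f mulrC [X in _ - X]mulrC EFinB !EFinM muleC.
  apply: integrableB => //; apply: integrableZl => //;
    exact: integrable_normal_pdf_moment.
pose I n : set R := `[- n.+1%:R, n.+1%:R].
pose g n := (EFin \o f) \_ (I n).
have [_ _] : [/\ mu.-integrable setT (EFin \o f),
    [sequence \int[mu]_x `|g n x - (EFin \o f) x|]_n @ \oo --> 0 &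
    [sequence \int[mu]_x g n x]_n @ \oo --> \int[mu]_x (EFin \o f) x]%E.
  apply: (@dominated_convergence _ _ _ mu setT measurableT g (EFin \o f)
    (abse \o (EFin \o f))).
  - move=> n; have mI : measurable (I n) by exact: measurable_itv.
    apply/(measurable_restrictT _ mI)/measurable_EFinP.
    exact: measurable_funTS.
  - exact/measurable_EFinP.
  (* Each x lies in [I n] from some n on, so the truncations are eventually constant at x. *)
  - apply: aeW => x _; apply: cvg_near_cst; near=> n.
    rewrite /g patchE mem_set // /I /= in_itv /= -ler_norml.
    apply: (@le_trans _ _ n%:R); last by rewrite ler_nat.
    near: n; exact: nbhs_infty_ger.
  - exact: integrable_abse.
  - apply: aeW => x n _; rewrite /g patchE; case: ifP => // _.
    by rewrite abse0 abse_ge0.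
have gE n : (\int[mu]_x g n x =
    (pdf_moment k n.+1%:R - pdf_moment k (- n.+1%:R))%:E)%E.
  rewrite /g -integral_mkcond (continuous_FTC2 (F := pdf_moment k)) //.
  - by rewrite gtrN ?ltr0n.
  - exact: continuous_subspaceT.
  - split.
    + move=> x _.
      exact: (@ex_derive _ _ _ _ _ _ _ (is_derive_pdf_moment k x)).
    + apply: cvg_at_right_filter; exact: continuous_pdf_moment.
    + apply: cvg_at_left_filter; exact: continuous_pdf_moment.
  - move=> x _; rewrite derive1E.
    exact: (@derive_val _ _ _ _ _ _ _ (is_derive_pdf_moment k x)).
move=> g_lim.
have [C [C0 HC]] := pdf_moment_vanish k.
have C_lim : 2 * C * n.+1%:R^-1 @[n --> \oo] --> (0 : R).
  rewrite -(mulr0 (2 * C)).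
  by apply: cvgM; [exact: cvg_cst|exact: cvg_harmonic].
have u_lim :
    pdf_moment k n.+1%:R - pdf_moment k (- n.+1%:R) @[n --> \oo] --> (0 : R).
  apply: norm_cvg0; apply: squeeze_cvgr C_lim; last exact: cvg_cst.
  near=> n; have [Cn Cn'] := HC n; rewrite normr_ge0 /=.
  rewrite (le_trans (ler_normB _ _)) // (le_trans (lerD Cn Cn')) //.
  by rewrite -mulrA mulr_natl mulr2n.
have g0 : [sequence (\int[mu]_x g n x)%E]_n @ \oo --> (0%R%:E : \bar R).
  apply: cvg_EFin; first by apply: nearW => m /=; rewrite gE.
  rewrite (_ : _ \o _ =
    fun m : nat => pdf_moment k m.+1%:R - pdf_moment k (- m.+1%:R)).
    exact: u_lim.
  by apply/funext => m /=; rewrite gE.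
exact: (cvg_unique _ g_lim g0).
Unshelve. all: by end_near. Qed.

Local Notation nu := (normal_prob 0 s).

Lemma normal_prob_density :
  ae_eq mu setT (Radon_Nikodym_SigmaFinite.f nu mu) (EFin \o pdf).
Proof.
apply: integral_ae_eq => //.
- exact: Radon_Nikodym_SigmaFinite.f_integrable (normal_prob_dominates 0 s).
- by apply/measurable_EFinP; exact: measurable_normal_pdf.
move=> A _ mA; rewrite -(Radon_Nikodym_SigmaFinite.f_integral) //.
exact: normal_prob_dominates.
Qed.

(** Change of variables through the Radon-Nikodym derivative, which is the density almost
    everywhere. It is applied to |f| for integrability, then to f. *)
Lemma integral_normal_prob (f : R -> R) : measurable_fun setT f ->
  mu.-integrable setT (fun x => (f x * pdf x)%:E) ->
  nu.-integrable setT (EFin \o f) /\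
  (\int[nu]_x (f x)%:E = \int[mu]_x (f x * pdf x)%:E)%E.
Proof.
move=> mf intf; have dom := normal_prob_dominates 0 s.
have mpdf : measurable_fun setT (EFin \o pdf).
  by apply/measurable_EFinP; exact: measurable_normal_pdf.
have mRN : measurable_fun setT (Radon_Nikodym_SigmaFinite.f nu mu).
  exact: measurable_int (Radon_Nikodym_SigmaFinite.f_integrable dom).
have intnu : nu.-integrable setT (EFin \o f).
  apply/integrableP; split; first exact/measurable_EFinP.
  rewrite -(Radon_Nikodym_SigmaFinite.change_of_variables dom) //; last first.
    by apply: measurableT_comp => //; exact/measurable_EFinP.
  have /integrableP[_] := intf; congr (_ < _)%E; apply: ae_eq_integral => //.
  - by apply: measurableT_comp => //; apply/measurable_EFinP/measurable_funM;
      rewrite // -/(EFin \o pdf); exact: measurable_normal_pdf.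
  - apply: emeasurable_funM => //; apply: measurableT_comp => //.
    exact/measurable_EFinP.
  apply: ae_eq_trans; last first.
    by apply: ae_eqe_mul2l; apply: ae_eq_sym; exact: normal_prob_density.
  apply: aeW => x _ /=.
  by rewrite normrM (ger0_norm (normal_pdf_ge0 0 s x)) EFinM.
split=> //.
rewrite -(Radon_Nikodym_change_of_variables dom) //.
apply: ae_eq_integral => //.
- by apply: emeasurable_funM => //; exact/measurable_EFinP.
- exact: measurable_int intf.
apply: ae_eq_trans; last first.
  by apply: aeW => x _; rewrite EFinM.
(* Two versions of the derivative occur here; they agree almost everywhere. *)
apply: ae_eqe_mul2l; apply: ae_eq_trans normal_prob_density.
by apply: ae_eq_sym; exact: ae_eq_Radon_Nikodym_SigmaFinite.
Qed.

End GaussianMoments.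

(** * Gaussian expectation of polynomials *)

Section GaussianTrace.
Variable R : realType.
Variable s : R.
Hypothesis s_neq0 : s != 0.
Local Notation mu := (@lebesgue_measure R).
Local Notation nu := (normal_prob 0 s).

Let lam (r : nat) : R := r%:R * s ^+ 2.

Lemma integrable_normal_expr k : nu.-integrable setT (fun x => (x ^+ k)%:E).
Proof.
have mX : measurable_fun setT (fun x : R => x ^+ k) by exact: measurable_funX.
by have [] := integral_normal_prob mX (integrable_normal_pdf_moment s_neq0 k).
Qed.

Lemma integrable_normal_poly (p : {poly R}) :
  nu.-integrable setT (fun x => p.[x]%:E).
Proof.
have -> : (fun x => p.[x]%:E) =
    (fun x => \sum_(j < size p) ((p`_j)%:E * (x ^+ j)%:E))%E.
  by apply/funext => x; rewrite horner_coef -sumEFin.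
apply: integrable_sum => // j _.
by apply: integrableZl => //; exact: integrable_normal_expr.
Qed.

Definition normal_trace (p : {poly R}) : R := fine (\int[nu]_x p.[x]%:E)%E.

Lemma normal_traceD : {morph normal_trace : p q / p + q}.
Proof.
move=> p q; rewrite /normal_trace.
under eq_integral do rewrite hornerD EFinD.
rewrite integralD //; try exact: integrable_normal_poly.
rewrite fineD //; apply: integrable_fin_num => //;
  exact: integrable_normal_poly.
Qed.

Lemma normal_traceZ c p : normal_trace (c%:P * p) = c * normal_trace p.
Proof.
rewrite /normal_trace; under eq_integral do rewrite hornerM hornerC EFinM.
rewrite integralZl //; last exact: integrable_normal_poly.
rewrite fineM //; apply: integrable_fin_num => //;
  exact: integrable_normal_poly.
Qed.

Lemma normal_trace0 : normal_trace 0 = 0.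
Proof. by rewrite -(mul0r (0 : {poly R})) -polyC0 normal_traceZ mul0r. Qed.

Lemma normal_trace1 : normal_trace 1 = 1.
Proof.
rewrite /normal_trace; under eq_integral do rewrite hornerC.
by rewrite integral_cst //= mul1e probability_setT.
Qed.

Lemma normal_trace_expr k :
  normal_trace ('X^(k.+1)) = s ^+ 2 * (k%:R * normal_trace ('X^(k.-1))).
Proof.
have nt j : normal_trace ('X^j) = fine (\int[mu]_x (pdf_moment s j x)%:E)%E.
  rewrite /normal_trace; congr fine.
  under eq_integral do rewrite hornerXn.
  have mX : measurable_fun setT (fun x : R => x ^+ j) by exact: measurable_funX.
  by have [_ ->] :=
    integral_normal_prob mX (integrable_normal_pdf_moment s_neq0 j).
have intj j : mu.-integrable setT (fun x => (pdf_moment s j x)%:E).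
  exact: integrable_normal_pdf_moment.
have finj j : (\int[mu]_x (pdf_moment s j x)%:E)%E \is a fin_num.
  exact: integrable_fin_num.
have := integral_pdf_moment_deriv s_neq0 k.
rewrite (eq_integral (fun x : measurableTypeR R =>
    k%:R%:E * (pdf_moment s k.-1 x)%:E -
    (s ^- 2)%:E * (pdf_moment s k.+1 x)%:E)%E); last first.
  by move=> x _; rewrite -!EFinM -EFinB (mulrC (s ^- 2)).
rewrite integralB //; [|exact: integrableZl|exact: integrableZl].
rewrite !integralZl //.
rewrite !nt -(fineK (finj k.-1)) -(fineK (finj k.+1)).
rewrite -!EFinM -EFinB => -[] /eqP; rewrite subr_eq0 => /eqP ->.
by rewrite mulVKf // expf_neq0.
Qed.

Lemma normal_trace_sum I (r : seq I) (F : I -> {poly R}) :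
  normal_trace (\sum_(i <- r) F i) = \sum_(i <- r) normal_trace (F i).
Proof. exact: (big_morph _ normal_traceD normal_trace0). Qed.

(** Stein's identity, obtained from the recurrence between moments by linearity. *)
Lemma normal_trace_ibp p : normal_trace ('X * p) = s ^+ 2 * normal_trace (p^`())%R.
Proof.
rewrite -[p]coefK poly_def mulr_sumr (raddf_sum (@deriv R)) !normal_trace_sum.
rewrite mulr_sumr.
apply: eq_bigr => j _.
rewrite /= derivZ derivXn -scalerAr -exprS -!mul_polyC -mulr_natl -polyC_natr.
by rewrite !normal_traceZ normal_trace_expr; ring.
Qed.

(** By Stein's identity and the derivative rule, the expectation of X H_(r+1) is s^2 (r + 1) times
    that of H_r, which the other term of the recurrence cancels. *)
Lemma normal_trace_orth_poly r : normal_trace (orth_poly lam r) = (r == 0%N)%:R.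
Proof.
case: r => [|[|r]]; first exact: normal_trace1.
  by rewrite /= subr0 normal_trace_ibp derivC normal_trace0 mulr0.
rewrite orth_polySS normal_traceD normal_trace_ibp orth_poly_deriv.
rewrite -scaleNr -!mul_polyC !normal_traceZ /lam /= mulr0n; ring.
Qed.

Lemma normal_traceE p : normal_trace p = orth_trace lam p.
Proof.
have H := @orth_trace_eval R R idfun {poly R} polyC normal_trace
  normal_traceD normal_trace0 normal_traceZ lam (orth_poly lam) 'X erefl.
have [||_ {}H] := H _ _ normal_trace_orth_poly; first by rewrite /= subr0 mulr1.
  by move=> r; rewrite orth_polySS mul_polyC subrK.
(* Here [orth_trace_eval] is used in the polynomial ring itself, where evaluation at X is the
   identity. *)
by rewrite -{1}(comp_polyXr p); exact: H.
Qed.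

End GaussianTrace.

(** * Independent random variables with given laws *)

Section IntegralProduct.
Context d1 d2 (T1 : measurableType d1) (T2 : measurableType d2) (R : realType).
Variable m1 : {sigma_finite_measure set T1 -> \bar R}.
Variable m2 : {sigma_finite_measure set T2 -> \bar R}.
Variables (F : T1 -> R) (G : T2 -> R).
Hypothesis intF : m1.-integrable setT (EFin \o F).
Hypothesis intG : m2.-integrable setT (EFin \o G).

Lemma integrable_prodM :
  (m1 \x m2)%E.-integrable setT (fun z => (F z.1 * G z.2)%:E).
Proof.
have mF : measurable_fun setT F by apply/measurable_EFinP/(measurable_int m1).
have mG : measurable_fun setT G by apply/measurable_EFinP/(measurable_int m2).
apply/integrable12ltyP.
  apply/measurable_EFinP/measurable_funM.
    exact: measurableT_comp mF measurable_fst.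
  exact: measurableT_comp mG measurable_snd.
have absG : m2.-integrable setT (fun y => `|(G y)%:E|)%E.
  exact: integrable_abse.
have absF : m1.-integrable setT (fun y => `|(F y)%:E|)%E.
  exact: integrable_abse.
rewrite (eq_integral
  (fun x => `|(F x)%:E| * \int[m2]_y `|(G y)%:E|)%E); last first.
  move=> x _; rewrite -integralZl //; apply: eq_integral => y _.
  by rewrite EFinM abseM abse_EFin.
have fG : (\int[m2]_y `|(G y)%:E|)%E \is a fin_num by exact: integrable_fin_num.
rewrite -(fineK fG) integralZr //.
by rewrite ltey_eq fin_numM // ?integrable_fin_num.
Qed.

Lemma integral_prodM :
  (\int[m1 \x m2]_z (F z.1 * G z.2)%:E =
   \int[m1]_x (F x)%:E * \int[m2]_y (G y)%:E)%E.
Proof.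
rewrite -integral12_prod_meas1 /=; last exact: integrable_prodM.
rewrite /fubini_F.
rewrite (eq_integral (fun x => (F x)%:E * \int[m2]_y (G y)%:E)%E); last first.
  by move=> x _; rewrite -integralZl.
have fG : (\int[m2]_y (G y)%:E)%E \is a fin_num by exact: integrable_fin_num.
by rewrite /= -(fineK fG) integralZr.
Qed.

End IntegralProduct.

Section IndependentFamily.
Variable R : realType.

(* The x i are independent with laws nu i: indicators f i give the product rule
   for events, and f i = (y |-> y ^+ k) the one for mixed moments. *)
Definition product_integrals d (T : measurableType d) (P : probability T R)
    (p : nat) (nu : 'I_p -> probability (measurableTypeR R) R)
    (x : 'I_p -> T -> R) : Prop :=
  forall f : 'I_p -> R -> R,
    (forall i, (nu i).-integrable setT (EFin \o f i)) ->
    P.-integrable setT (fun w => (\prod_i f i (x i w))%:E) /\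
    (\int[P]_w (\prod_i f i (x i w))%:E = \prod_i \int[nu i]_y (f i y)%:E)%E.

(** Induction on [p] by binary product measures: the new factor carries the variable of index 0, and
    the others are read off the first component. *)
Lemma independent_family_exists (p : nat)
    (nu : 'I_p -> probability (measurableTypeR R) R) :
  exists (d : measure_display) (T : measurableType d) (P : probability T R)
      (x : 'I_p -> T -> R),
    (forall i, measurable_fun setT (x i)) /\ product_integrals P nu x.
Proof.
elim: p nu => [|p IH] nu.
  (* For the empty family any probability would do. *)
  pose delta : probability (measurableTypeR R) R :=
    @dirac _ (measurableTypeR R) (0 : R) R.
  exists _, (measurableTypeR R), delta, (fun _ _ => 0); split=> // f _.
  under eq_fun do rewrite big_ord0.
  rewrite big_ord0; split; first exact: finite_measure_integrable_cst.
  by rewrite integral_cst //= diracT mule1.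
have [d [T [P [x [mx HP]]]]] := IH (fun j => nu (lift ord0 j)).
pose Q : probability (T * measurableTypeR R)%type R := (P \x nu ord0)%E.
exists _, (T * measurableTypeR R)%type, Q.
exists (fun i w => if unlift ord0 i is Some j then x j w.1 else w.2).
split.
  move=> i; case: unliftP => [j _|_]; last exact: measurable_snd.
  by apply: measurableT_comp (mx j) _.
move=> f intf.
have [intF EF] := HP (fun j => f (lift ord0 j)) (fun j => intf _).
have fE (w : T * R) :
    \prod_i f i (if unlift ord0 i is Some j then x j w.1 else w.2) =
    (\prod_j f (lift ord0 j) (x j w.1)) * f ord0 w.2.
  rewrite big_ord_recl unlift_none mulrC; congr (_ * _).
  by apply: eq_bigr => j _; rewrite liftK.
  split.
  apply: eq_integrable (integrable_prodM intF (intf ord0)) => // w _.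
  by congr EFin; rewrite -fE.
rewrite big_ord_recl -EF muleC -(integral_prodM intF (intf ord0)).
by apply: eq_integral => w _; congr EFin; rewrite -fE.
Qed.

End IndependentFamily.

Section Independence.
Variables (R : realType) (d : measure_display) (T : measurableType d).
Variables (P : probability T R) (p : nat).
Variables (nu : 'I_p -> probability (measurableTypeR R) R) (x : 'I_p -> T -> R).
Hypothesis HP : product_integrals P nu x.
Hypothesis mx : forall i, measurable_fun setT (x i).

Lemma product_integrals_preimage (J : {set 'I_p}) (B : 'I_p -> set R) :
  (forall i, i \in J -> measurable (B i)) ->
  P (\bigcap_(i in [set` J]) (x i @^-1` B i)) = (\prod_(i in J) nu i (B i))%E.
Proof.
move=> mB.
(* The constant 1 outside [J] reduces events indexed by [J] to a product over all indices. *)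
pose f i : R -> R := if i \in J then \1_(B i) else cst 1.
have mBx i : i \in J -> measurable (x i @^-1` B i).
  by move=> iJ; rewrite -[X in measurable X]setTI; apply: mx => //; exact: mB.
have intf i : (nu i).-integrable setT (EFin \o f i).
  rewrite /f; case: ifP => iJ; last exact: finite_measure_integrable_cst.
  by apply: integrable_indic => //; exact: mB.
have [_] := HP intf.
have -> : (\prod_i \int[nu i]_y (f i y)%:E = \prod_(i in J) nu i (B i))%E.
  rewrite [RHS]big_mkcond /=; apply: eq_bigr => i _; rewrite /f.
  case: ifP => iJ; last first.
    rewrite -[LHS]/(\int[nu i]_y (cst 1%E y))%E integral_cst //=.
    by rewrite mul1e probability_setT.
  by rewrite integral_indic ?setIT //; exact: mB.
move=> <-; set C := \bigcap_(i in _) _.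
have mC : measurable C.
  apply: fin_bigcap_measurable => //; exact: mBx.
rewrite -[in LHS](setIT C) -integral_indic //; apply: eq_integral => w _.
congr EFin; rewrite indicE; case: (boolP (w \in C)) => [|].
  rewrite inE => wC; rewrite big1 // => i _; rewrite /f; case: ifP => // iJ.
  by rewrite indicE mem_set //; exact: wC.
rewrite notin_setE => wC.
have [i iJ wi] : exists2 i, i \in J & ~ B i (x i w).
  apply: contra_notP wC => nE i /= iJ; apply: contrapT => Bi.
  by apply: nE; exists i.
by rewrite (bigD1 i) //= {1}/f iJ indicE memNset // mul0r.
Qed.

Lemma product_integrals_independent (h : 'I_p -> R -> R)
    (X : 'I_p -> {RV P >-> R}) :
  (forall i, measurable_fun setT (h i)) ->
  (forall i, X i = h i \o x i :> (T -> R)) -> mutually_independent X.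
Proof.
move=> mh Xx J B mB.
pose B' i := h i @^-1` B i.
have mB' i : i \in J -> measurable (B' i).
  by move=> iJ; rewrite -[B' i]setTI; apply: mh => //; exact: mB.
have XB i : X i @^-1` B i = x i @^-1` B' i by rewrite Xx.
under eq_bigcapr do rewrite XB.
rewrite product_integrals_preimage //; apply: eq_bigr => i iJ.
(* The case of a single index identifies the law of [x i] as [nu i]. *)
have := @product_integrals_preimage [set i]%SET B'.
rewrite big_set1 => <-; last by move=> j; rewrite inE => /eqP ->; exact: mB'.
congr (P _); rewrite XB; apply/seteqP; split=> w /=.
  by move=> /(_ i); apply; rewrite /= inE.
by move=> Bw j /=; rewrite inE => /eqP ->.
Qed.

Lemma product_integrals_comp (h : 'I_p -> R -> R) i :
  (nu i).-integrable setT (EFin \o h i) ->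
  P.-integrable setT (fun w => (h i (x i w))%:E).
Proof.
move=> hi; pose f j := if j == i then h i else cst 1.
have [|+ _] := HP (f := f).
  move=> j; rewrite /f; case: eqP => [->//|_].
  exact: finite_measure_integrable_cst.
apply: eq_integrable => // w _; congr EFin.
rewrite (bigD1 i) //= /f eqxx big1 ?mulr1 // => j /negbTE ->.
by [].
Qed.

End Independence.

(** * Asymptotics *)

Lemma card_ord_gt M a : #|[pred k : 'I_M.+1 | (a < k)%N]| = (M - a)%N.
Proof.
rewrite -sum1_card -(big_mkord (fun k => a < k)%N (fun=> 1%N)).
elim: M => [|M IH]; first by rewrite big_mkcond big_nat1 ltn0.
rewrite big_mkcond big_nat_recr //= -big_mkcond IH.
by case: ltnP => H; lia.
Qed.

Section Moments.
Variable R : realType.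
Variables s t : R.
Hypotheses (s_ge0 : 0 <= s) (st : s < t).

(** The count is the difference of the integer parts of n t and n s, so the error is a difference of
    two fractional parts. *)
Lemma itv_card_bound n : `|(itv_card s t n)%:R - n%:R * (t - s)| <= 1.
Proof.
have nt0 : 0 <= n%:R * t by rewrite mulr_ge0 // (le_trans s_ge0) // ltW.
have ns0 : 0 <= n%:R * s by rewrite mulr_ge0.
rewrite /itv_card.
rewrite (_ : #|_| = (Num.truncn (n%:R * t) - Num.truncn (n%:R * s))%N); last first.
  rewrite -card_ord_gt; apply: eq_card => k.
  rewrite [LHS]unfold_in [RHS]unfold_in /=.
  rewrite /itv_pred truncn_lt_nat //.
  by rewrite -truncn_ge_nat // -ltnS ltn_ord andbT.
rewrite natrB; last by apply: le_truncn; rewrite ler_wpM2l // ltW.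
have /andP[t1 t2] := truncn_itv nt0; have /andP[s1 s2] := truncn_itv ns0.
move: t2 s2; rewrite -!natr1 ler_norml => t2 s2; rewrite mulrBr; lra.
Qed.

(* At r = 0 the junk value of r.-1 is multiplied by 0. *)
Definition lelem_coef n r : R := r%:R * ((itv_card s t n)%:R - r.-1%:R) / n%:R.

Lemma cvg_lelem_coef r : lelem_coef n r @[n --> \oo] --> r%:R * (t - s).
Proof.
have inv0 : n%:R^-1 @[n --> \oo] --> (0 : R).
  apply/gtr0_cvgV0; last exact: cvgr_idn.
  by near=> n; rewrite ltr0n; near: n; exact: nbhs_infty_gt.
have N0 : (itv_card s t n)%:R / n%:R @[n --> \oo] --> t - s.
  apply/cvgrPdist_le => e e0; near=> n.
  have n0 : (0 : R) < n%:R by rewrite ltr0n; near: n; exact: nbhs_infty_gt.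
  rewrite distrC.
  rewrite (_ : _ - _ = ((itv_card s t n)%:R - n%:R * (t - s)) / n%:R); last first.
    by field; rewrite gt_eqF.
  rewrite normrM normfV (gtr0_norm n0) ler_pdivrMr //.
  apply: le_trans (itv_card_bound n) _.
  rewrite -ler_pdivrMl // mulr1; near: n; exact: nbhs_infty_ger.
have -> : lelem_coef^~ r = (fun n =>
    r%:R * ((itv_card s t n)%:R / n%:R - r.-1%:R * n%:R^-1)).
  by apply/funext => n; rewrite /lelem_coef; ring.
have -> : r%:R * (t - s) = r%:R * (t - s - r.-1%:R * 0) by rewrite mulr0 subr0.
apply: cvgM; first exact: cvg_cst.
by apply: cvgB => //; apply: cvgM => //; exact: cvg_cst.
Unshelve. all: by end_near. Qed.

(** [orth_trace_eval] in the group algebra, with X the element of index 1. *)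
Lemma trace_Lelem_power r n k : (0 < n)%N ->
  canonical_trace (Lelem r s t n ^+ k) =
  (orth_trace (lelem_coef n) (orth_poly (lelem_coef n) r ^+ k))%:C%C.
Proof.
move=> n0.
have [] := @orth_trace_eval R R[i] (real_complex R) (galg R[i] finsets)
  (real_galg R) (@canonical_trace _ _) (@canonical_traceD _) (canonical_trace0 _) _
  (lelem_coef n) (fun r => Lelem r s t n) (Lelem 1 s t n) (Lelem0 s t n) erefl.
- by move=> c x; rewrite real_galgE /canonical_trace gcoefZ.
- move=> q; apply: etrans (Lelem_rec s t n0 q) _.
  (* Rewriting with real_galgE would unfold Lelem and not terminate. *)
  by congr (_ + _); apply: esym; exact: real_galgE.
- by move=> q; exact: trace_Lelem.
move=> Lr /(_ (orth_poly (lelem_coef n) r ^+ k)).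
by rewrite rmorphXn /= horner_exp -(Lr r).
Qed.

Lemma cvg_moment r k :
  orth_trace (lelem_coef n) (orth_poly (lelem_coef n) r ^+ k) @[n --> \oo] -->
  orth_trace (fun j => j%:R * (t - s))
    (orth_poly (fun j => j%:R * (t - s)) r ^+ k).
Proof. by apply: cvg_orth_trace_power => j; exact: cvg_lelem_coef. Qed.

End Moments.

(** Expansion into monomials reduces this to [canonical_trace_prod]; only the moments of each single
    element remain. *)
Lemma joint_distribution_disjoint (K : comNzRingType) (p : nat)
    (D : 'I_p -> {pred nat}) (y : 'I_p -> galg K finsets) (Q : mpoly p K) :
  (forall i, supported_on (D i) (y i)) ->
  (forall i j k, k \in D i -> k \in D j -> i = j) ->
  joint_distribution (@canonical_trace K finsets) y Q =
  \sum_(m <- mpoly.msupp Q)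
    mpoly.mcoeff m Q * \prod_i canonical_trace (y i ^+ (fun_of_multinom m i)).
Proof.
move=> yD DD; rewrite /joint_distribution /mpoly.mmap.
rewrite (big_morph _ (@canonical_traceD K) (canonical_trace0 K)).
apply: eq_bigr => m _; rewrite mulr_algl /canonical_trace gcoefZ; congr (_ * _).
rewrite -/(canonical_trace _) /mpoly.mmap1.
apply: (canonical_trace_prod (D := D)) => // [|i].
  exact: index_enum_uniq.
exact: supported_onX.
Qed.

(** * Passage from real to complex values *)

Section Complex.
Variable R : realType.

Lemma cvg_complex (u : nat -> R) (l : R) : u n @[n --> \oo] --> l ->
  ((u n)%:C%C : (R[i])^o) @[n --> \oo] --> (l%:C%C : (R[i])^o).
Proof.
move=> /cvgrPdist_lt ul; apply/cvgrPdist_lt => e e0.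
(* A positive element for the order of R[i] is real. *)
have eE : e = (complex.Re e)%:C%C.
  by case: e e0 => a b; rewrite ltcE /= => /andP[/eqP -> _].
have Re0 : 0 < complex.Re e by rewrite eE ltcR in e0.
have := ul _ Re0; apply: filterS => n un.
by rewrite eE -rmorphB normc_def /= ?expr0n /= addr0 sqrtr_sqr ltcR.
Qed.

Lemma ReD_sum I (s : seq I) (F : I -> R[i]) :
  complex.Re (\sum_(i <- s) F i) = \sum_(i <- s) complex.Re (F i).
Proof. by apply: big_morph => // -[a b] [c e]. Qed.

Lemma ImD_sum I (s : seq I) (F : I -> R[i]) :
  complex.Im (\sum_(i <- s) F i) = \sum_(i <- s) complex.Im (F i).
Proof. by apply: big_morph => // -[a b] [c e]. Qed.

End Complex.

(** The monomials in the variables are real, so taking real and imaginary parts affects only the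
    coefficients of [Q]. *)
Lemma classical_joint_distributionE (R : realType) d (T : measurableType d)
    (P : probability T R) (p : nat) (x : 'I_p -> {RV P >-> R})
    (l : multinom p -> R) (Q : mpoly p R[i]) :
  (forall m, P.-integrable setT
    (fun w => (\prod_i x i w ^+ fun_of_multinom m i)%:E)) ->
  (forall m,
    \int[P]_w (\prod_i x i w ^+ fun_of_multinom m i)%:E = (l m)%:E)%E ->
  classical_joint_distribution x Q =
  \sum_(m <- mpoly.msupp Q) mpoly.mcoeff m Q * (l m)%:C%C.
Proof.
move=> intx El.
have EY (a : multinom p -> R) :
    fine ('E_P[fun w => \sum_(m <- mpoly.msupp Q)
      a m * \prod_i x i w ^+ fun_of_multinom m i]) =
    \sum_(m <- mpoly.msupp Q) a m * l m.
  rewrite unlock.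
  under eq_integral do rewrite -sumEFin.
  rewrite integral_sum //; last first.
    move=> m; under eq_fun do rewrite EFinM.
    exact: integrableZl.
  rewrite (eq_bigr (fun m => (a m * l m)%:E)) ?sumEFin // => m _.
  under eq_integral do rewrite EFinM.
  by rewrite integralZl // El EFinM.
have RI (w : T) : meval (fun i => (x i w)%:C%C) Q =
    \sum_(m <- mpoly.msupp Q)
      mpoly.mcoeff m Q * (\prod_i x i w ^+ fun_of_multinom m i)%:C%C.
  rewrite mpoly.mevalE; apply: eq_bigr => m _; congr (_ * _).
  by rewrite rmorph_prod; apply: eq_bigr => i _; rewrite rmorphXn.
have ReM (z : R[i]) (b : R) : complex.Re (z * b%:C%C) = complex.Re z * b.
  by case: z => z1 z2 /=; rewrite mulr0 subr0.
have ImM (z : R[i]) (b : R) : complex.Im (z * b%:C%C) = complex.Im z * b.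
  by case: z => z1 z2 /=; rewrite mulr0 add0r.
rewrite /classical_joint_distribution /Cexpectation.
have ReE : (fun w => complex.Re (meval (fun i => (x i w)%:C%C) Q)) =
    (fun w => \sum_(m <- mpoly.msupp Q) complex.Re (mpoly.mcoeff m Q) *
      \prod_i x i w ^+ fun_of_multinom m i).
  by apply/funext => w; rewrite RI ReD_sum; apply: eq_bigr => m _; rewrite ReM.
have ImE : (fun w => complex.Im (meval (fun i => (x i w)%:C%C) Q)) =
    (fun w => \sum_(m <- mpoly.msupp Q) complex.Im (mpoly.mcoeff m Q) *
      \prod_i x i w ^+ fun_of_multinom m i).
  by apply/funext => w; rewrite RI ImD_sum; apply: eq_bigr => m _; rewrite ImM.
rewrite ReE ImE !EY; apply/eqP; rewrite eq_complex /= ReD_sum ImD_sum.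
by apply/andP; split; apply/eqP; apply: eq_bigr => m _; rewrite (ReM, ImM).
Qed.

(** * Convergence of the joint moments *)

Section Main.
Variables (R : realType) (p : nat) (r : 'I_p -> nat) (t : 'I_p.+1 -> R).
Hypothesis ht0 : 0 <= t ord0.
Hypothesis ht : forall i j : 'I_p.+1, (i < j)%N -> t i < t j.

Let lo (i : 'I_p) := t (widen_ord (leqnSn p) i).
Let hi (i : 'I_p) := t (lift ord0 i).

Let lo_ge0 i : 0 <= lo i.
Proof.
apply: le_trans ht0 _; rewrite /lo; have [i0|i0] := posnP i.
  by rewrite (_ : widen_ord _ _ = ord0) //; exact: val_inj.
by apply/ltW/ht.
Qed.

Let lo_hi i : lo i < hi i.
Proof. by apply: ht; rewrite /= /bump /= add1n ltnS. Qed.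

Let hi_lo (i j : 'I_p) : (i < j)%N -> hi i <= lo j.
Proof.
move=> ij; rewrite /hi /lo.
have [e|ne] := eqVneq (lift ord0 i) (widen_ord (leqnSn p) j).
  by rewrite e.
apply/ltW/ht; rewrite ltn_neqAle /= /bump /= add1n ij andbT.
by move: ne; rewrite -val_eqE /= /bump /= add1n.
Qed.

(** Adjacent intervals may share an endpoint, but being open on the left they stay disjoint. *)
Let in_itv_inj n (i j : 'I_p) (k : nat) :
  k \in [pred k | n%:R * lo i < k%:R <= n%:R * hi i] ->
  k \in [pred k | n%:R * lo j < k%:R <= n%:R * hi j] -> i = j.
Proof.
rewrite !inE => /andP[i1 i2] /andP[j1 j2]; apply/eqP; rewrite -(inj_eq val_inj).
have sep (a b : 'I_p) : (a < b)%N -> n%:R * hi a <= n%:R * lo b.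
  by move=> ab; rewrite ler_wpM2l // hi_lo.
case: ltngtP => // /sep H.
  by have := le_lt_trans (le_trans i2 H) j1; rewrite ltxx.
by have := le_lt_trans (le_trans j2 H) i1; rewrite ltxx.
Qed.

Let c i := hi i - lo i.
Let h i : {poly R} := orth_poly (fun j => j%:R * c i) (r i).

Let sd_neq0 i : Num.sqrt (c i) != 0.
Proof. by rewrite gt_eqF // sqrtr_gt0 subr_gt0 lo_hi. Qed.

Let normal_powers i k :
  (\int[normal_prob 0 (Num.sqrt (c i))]_y ((h i).[y] ^+ k)%:E =
   (orth_trace (fun j => j%:R * c i) (h i ^+ k))%:E)%E.
Proof.
under eq_integral do rewrite -horner_exp.
rewrite -[LHS]fineK; last first.
  by apply: integrable_fin_num => //; exact: integrable_normal_poly.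
congr EFin; rewrite -/(normal_trace _ _) normal_traceE //; congr orth_trace.
by apply/funext => j; rewrite sqr_sqrtr // subr_ge0 ltW.
Qed.

Lemma asymptotically_independent_Lelem :
  asymptotically_independent (@canonical_trace R[i] finsets)
    (fun n i => Lelem (r i) (lo i) (hi i) n).
Proof.
have [d [T [P [g [mg HP]]]]] :=
  @independent_family_exists R p (fun i => normal_prob 0 (Num.sqrt (c i))).
have mh i : measurable_fun setT (horner (h i)).
  by apply: continuous_measurable_fun; exact: continuous_horner.
have mx i : measurable_fun setT (horner (h i) \o g i).
  exact: measurableT_comp.
(* The limits are Hermite polynomials of degrees [r i] in independent centered Gaussian variables of
   variances [c i]. *)
pose x i : {RV P >-> R} := mfun_Sub (mem_set (mx i)).
have intpow i k : (normal_prob 0 (Num.sqrt (c i))).-integrable setT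
    (fun y => ((h i).[y] ^+ k)%:E).
  under eq_fun do rewrite -horner_exp.
  exact: integrable_normal_poly.
exists d, T, P, x; split.
- by apply: (product_integrals_independent HP mg mh).
- move=> i k.
  by have := product_integrals_comp HP (h := fun i y => (h i).[y] ^+ k)
    (intpow i k).
move=> Q.
have HQ (m : multinom p) :=
  HP (fun i y => (h i).[y] ^+ fun_of_multinom m i) (fun i => intpow i _).
pose l (m : multinom p) :=
  \prod_i orth_trace (fun j => j%:R * c i) (h i ^+ fun_of_multinom m i).
rewrite (@classical_joint_distributionE _ _ _ _ _ _ l); first last.
- move=> m; have [_ ->] := HQ m.
  by rewrite (eq_bigr _ (fun i _ => normal_powers i _)) prodEFin.
- by move=> m; have [] := HQ m.
pose u n (m : multinom p) := \prod_i orth_trace (lelem_coef (lo i) (hi i) n)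
  (orth_poly (lelem_coef (lo i) (hi i) n) (r i) ^+ fun_of_multinom m i).
have main :
    (\sum_(m <- mpoly.msupp Q) mpoly.mcoeff m Q * (u n m)%:C%C : (R[i])^o)
    @[n --> \oo] -->
    (\sum_(m <- mpoly.msupp Q) mpoly.mcoeff m Q * (l m)%:C%C : (R[i])^o).
  apply: cvg_big => [z|m _]; first exact: add_continuous.
  apply: cvgM; first exact: cvg_cst.
  apply: cvg_complex; apply: cvg_prodr => i.
  exact: cvg_moment.
(* The trace formula needs n > 0, so equality with the convergent sequence holds only eventually. *)
apply: cvg_trans main; apply: near_eq_cvg; near=> n.
have n0 : (0 < n)%N by near: n; exact: nbhs_infty_gt.
rewrite (joint_distribution_disjoint
  (D := fun i => [pred k | n%:R * lo i < k%:R <= n%:R * hi i])).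
- apply: eq_bigr => m _; congr (_ * _); rewrite rmorph_prod.
  apply: eq_bigr => i _.
  by rewrite trace_Lelem_power.
- by move=> i; exact: supported_on_Lelem.
- by move=> i j k; exact: in_itv_inj.
Unshelve. all: by end_near. Qed.

End Main.

Local Close Scope classical_set_scope.
Unset Implicit Arguments.

Theorem corollary4 (R : realType) (p : nat) (hp : (1 <= p)%N)
    (r : 'I_p -> nat) (t : 'I_p.+1 -> R)
    (ht0 : 0 <= t ord0)
    (ht : forall i j : 'I_p.+1, (i < j)%N -> t i < t j) :
  asymptotically_independent (@canonical_trace R[i] finsets)
    (fun n (i : 'I_p) =>
       Lelem (r i) (t (widen_ord (leqnSn p) i)) (t (lift ord0 i)) n).
Proof. exact: asymptotically_independent_Lelem. Qed.
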